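(* Let $T$ be a finite tree, let $T^2$ be its square, and let $\Bbbk$ be a field. The following are equivalent: (a) the edge ideal $I(T^2)\subseteq S=\Bbbk[x_v : v\in V(T)]$ has a linear resolution; (b) $T$ is one of the following graphs: (i) the path $L_n$ with $2\le n\le 5$; (ii) a star graph; (iii) a (partially) whiskered star.
   Context: All graphs are finite and simple. For a graph $G$, the square $G^2$ is the graph on $V(G)$ whose edges are the pairs $\{x,y\}$ with $x\neq y$ and $\mathrm{dist}_G(x,y)\in\{1,2\}$. The edge ideal of a graph $G$ on vertex set $V$ is $I(G)=\langle x_ux_v : \{u,v\}\in E(G)\rangle\subseteq \Bbbk[x_v: v\in V]$. An ideal generated by quadrics has a linear resolution if its graded Betti numbers satisfy $\beta_{i,j}(I)=0$ for all $j\neq i+2$. $L_n$ denotes the path on $n$ vertices. A star graph is $K_{1,t}$ ($t\ge1$): one center adjacent to $t$ vertices of degree 1 and no other edges. A (partially) whiskered star is the tree with vertex set $\{x_0,x_1,\dots,x_n,y_1,\dots,y_m\}$, where $n\ge1$ and $1\le m\le n$, and edge set $\{\{x_0,x_i\}:1\le i\le n\}\cup\{\{x_i,y_i\}:1\le i\le m\}$.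
   Formalization: The tree is assumed to have at least two vertices: for the one-vertex tree the edge ideal is zero, so (a) holds vacuously, while the tree is none of the graphs listed in (b). *)

(* Defs.v *)
From HB Require Import structures.
From mathcomp Require Import all_boot all_order all_algebra.
From mathcomp Require Import mpoly.
Set Implicit Arguments. Unset Strict Implicit. Unset Printing Implicit Defensive.
Import GRing.Theory.
Local Open Scope ring_scope.

Definition simple_graph (V : finType) (e : rel V) : Prop :=
  ssrbool.symmetric e /\ ssrbool.irreflexive e.

Definition graph_connected (V : finType) (e : rel V) : Prop :=
  forall x y : V, connect e x y.

Definition graph_acyclic (V : finType) (e : rel V) : Prop :=
  forall c : seq V, (3 <= size c)%N -> uniq c -> ~~ cycle e c.

Definition is_tree (V : finType) (e : rel V) : Prop :=
  [/\ simple_graph e, (0 < #|V|)%N, graph_connected e & graph_acyclic e].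

Definition graph_square (V : finType) (e : rel V) : rel V :=
  fun x y => (x != y) && (e x y || [exists z, e x z && e z y]).

Definition graph_iso (V W : finType) (e : rel V) (f : rel W) : Prop :=
  exists g : V -> W, bijective g /\ forall u v, e u v = f (g u) (g v).

Definition path_graph (m : nat) : rel 'I_m :=
  fun i j => (i.+1 == j :> nat)%N || (j.+1 == i :> nat)%N.

Definition star_graph (t : nat) : rel (option 'I_t) :=
  fun x y => match x, y with
             | None, Some _ | Some _, None => true
             | _, _ => false
             end.

(* The (partially) whiskered star with x_0 = None, x_{i+1} = Some (inl i)
   (i < k), y_{j+1} = Some (inr j) (j < m); edges x_0 x_i and x_j y_j. *)
Definition wstar_graph (k m : nat) : rel (option ('I_k + 'I_m)) :=
  fun x y => match x, y with
             | None, Some (inl _) | Some (inl _), None => true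
             | Some (inl i), Some (inr j) | Some (inr j), Some (inl i) =>
                 (i == j :> nat)
             | _, _ => false
             end.

Definition in_edge_ideal (F : fieldType) (n : nat) (e : rel 'I_n)
    (p : {mpoly F[n]}) : Prop :=
  exists c : 'I_n -> 'I_n -> {mpoly F[n]},
    p = \sum_(u : 'I_n) \sum_(v : 'I_n | e u v) c u v * ('X_u * 'X_v).

(* I(G) has a linear resolution: there is a graded free resolution
     ... -> S(-3)^{d 1} --A 0--> S(-2)^{d 0} --g--> I(G) -> 0
   with F_i = S(-i-2)^{d i}, i.e. all differentials are matrices of linear
   forms (row-vector convention: v |-> v *m A).  Since all entries lie in the
   irrelevant ideal such a resolution is minimal, so this is exactly the
   condition beta_{i,j}(I) = 0 for j <> i+2. *)
Definition has_linear_resolution (F : fieldType) (n : nat) (e : rel 'I_n)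
  : Prop :=
  exists (d : nat -> nat) (g : 'cV[{mpoly F[n]}]_(d 0%N))
         (A : forall i : nat, 'M[{mpoly F[n]}]_(d i.+1, d i)),
    [/\
        (forall k, g k 0 \is 2.-homog),
        (forall p, in_edge_ideal e p <->
                   exists v : 'rV_(d 0%N), (v *m g) 0 0 = p),
        (forall i (r : 'I_(d i.+1)) (s : 'I_(d i)), A i r s \is 1.-homog) &
      [/\
        A 0%N *m g = 0,
        (forall v : 'rV_(d 0%N), v *m g = 0 ->
            exists w : 'rV_(d 1%N), w *m A 0%N = v),
        (forall i, A i.+1 *m A i = 0) &
        (forall i (v : 'rV_(d i.+1)), v *m A i = 0 ->
            exists w : 'rV_(d i.+2), w *m A i.+1 = v)]].

Arguments path_graph m : clear implicits.
Arguments star_graph t : clear implicits.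
Arguments wstar_graph k m : clear implicits.
Arguments has_linear_resolution F n e : clear implicits.
Arguments in_edge_ideal F n e p : clear implicits.

(* Main.v *)
Require Import Defs.
From HB Require Import structures.
From mathcomp Require Import all_boot all_order all_algebra.
From mathcomp Require Import mpoly zify.
From Stdlib Require Import ClassicalEpsilon.
Set Implicit Arguments. Unset Strict Implicit. Unset Printing Implicit Defensive.

(* All the listed trees are stars or partially whiskered stars, and these are
   exactly the trees T whose square contains no gap, i.e. no two edges joined
   by no further edge.

   If the square has two edges ab and cd forming a gap, the Koszul syzygy
   between x_a x_b and x_c x_d is not a combination of linear syzygies: a
   linear syzygy of the generators has, in the multidegrees x_a x_b x_c and
   x_a x_b x_d, no contribution besides that of x_a x_b itself.  So a linear
   resolution forces T^2 to be gap free.  Then a vertex whose closed 2-ball is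
   largest dominates T^2, since otherwise T contains a path on six vertices,
   whose end edges form a gap; a dominating vertex of largest degree is the
   center of a partially whiskered star.

   Conversely, the square of a listed tree is a split graph: a clique K touches
   every edge.  Adding first the edges inside K and then the others, one at a
   time, every colon ideal is generated by variables, so that mapping cones
   yield a linear resolution, starting from the zero ideal.  The same mapping
   cones, for ideals generated in degree 1, resolve the ideals of variables. *)

(** * Linear resolutions and mapping cones *)

Section LinearResolutions.

Import GRing.Theory.
Local Open Scope ring_scope.

Variables (F : fieldType) (n : nat).
Local Notation S := {mpoly F[n]}.

Definition homog_mx (k p q : nat) (A : 'M[S]_(p, q)) : Prop :=
  forall i j, A i j \is k.-homog.

Lemma pihomogM (k d : nat) (p q : S) :
  q \is d.-homog -> pihomog mdeg (k + d) (p * q) = pihomog mdeg k p * q.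
Proof.
move=> hq; pose K := maxn (msize p) k.+1.
rewrite {1}(pihomog_partitionE (mf := mdeg) (k := K) (p := p)) ?leq_maxl //.
have ltkK : (k < K)%N by rewrite leq_max leqnn orbT.
rewrite mulr_suml raddf_sum /= (bigD1 (Ordinal ltkK)) //= big1 ?addr0.
  by rewrite pihomog_dE // dhomogM // pihomogP.
move=> i ne_ik; rewrite (@pihomog_ne0 _ _ _ (i + d)%N) //.
  by rewrite eqn_add2r; apply: contra ne_ik => /eqP e; apply/eqP/val_inj.
by rewrite dhomogM // pihomogP.
Qed.

Lemma map_pihomog_mul (k d p q r : nat) (w : 'M[S]_(p, q)) (A : 'M[S]_(q, r)) :
  homog_mx d A ->
  map_mx (pihomog mdeg (k + d)) (w *m A) = map_mx (pihomog mdeg k) w *m A.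
Proof.
move=> hA; apply/matrixP => i j; rewrite !mxE raddf_sum /=.
by apply: eq_bigr => l _; rewrite mxE pihomogM.
Qed.

Lemma homog_mx_pihomog (k p q : nat) (w : 'M[S]_(p, q)) :
  homog_mx k (map_mx (pihomog mdeg k) w).
Proof. by move=> i j; rewrite mxE pihomogP. Qed.

Lemma homog_mxM (k d p q r : nat) (A : 'M[S]_(p, q)) (B : 'M[S]_(q, r)) :
  homog_mx k A -> homog_mx d B -> homog_mx (k + d) (A *m B).
Proof.
by move=> hA hB i j; rewrite mxE rpred_sum // => l _; apply: dhomogM.
Qed.

Lemma homog_mxN (k p q : nat) (A : 'M[S]_(p, q)) :
  homog_mx k A -> homog_mx k (- A).
Proof. by move=> hA i j; rewrite mxE rpredN. Qed.

Lemma homog_block_mx (k p1 p2 q1 q2 : nat) (A : 'M[S]_(p1, q1))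
    (B : 'M[S]_(p1, q2)) (C : 'M[S]_(p2, q1)) (D : 'M[S]_(p2, q2)) :
  homog_mx k A -> homog_mx k B -> homog_mx k C -> homog_mx k D ->
  homog_mx k (block_mx A B C D).
Proof.
by move=> hA hB hC hD i j; case: (split_ordP i) => i' ->;
  case: (split_ordP j) => j' ->;
  rewrite ?block_mxEul ?block_mxEur ?block_mxEdl ?block_mxEdr.
Qed.

Lemma homog_mx0 (k p q : nat) : homog_mx k (0 : 'M[S]_(p, q)).
Proof. by move=> i j; rewrite mxE rpred0. Qed.

(** A solution found row by row may be inhomogeneous, but its component of degree [k] is again a
    solution because [A] and [B] are homogeneous. *)
Lemma homog_lift (k d p q r : nat) (A : 'M[S]_(q, r)) (B : 'M[S]_(p, r)) :
  homog_mx d A -> homog_mx (k + d) B ->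
  (forall i, exists w : 'rV_q, w *m A = row i B) ->
  exists2 W : 'M_(p, q), homog_mx k W & W *m A = B.
Proof.
move=> hA hB /fin_all_exists[w hw].
exists (map_mx (pihomog mdeg k) (\matrix_i w i)); first exact: homog_mx_pihomog.
rewrite -(map_pihomog_mul _ _ hA) //; apply/matrixP => i j.
rewrite mxE.
have -> : ((\matrix_i w i) *m A) i j = (w i *m A) 0 j.
  by rewrite !mxE; apply: eq_bigr => l _; rewrite !mxE.
by rewrite hw mxE pihomog_dE.
Qed.

Definition syzygy_exact (p q r : nat) (A : 'M[S]_(r, p)) (g : 'M[S]_(p, q)) :=
  forall v : 'rV_p, v *m g = 0 -> exists w : 'rV_r, w *m A = v.

(** Coinduction allows an unending sequence of matrices whose sizes change at each stage. Only the
    matrices after [g] have to be linear, so [g] may hold generators of any degree. *)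
CoInductive linear_syzygies : forall p q : nat, 'M[S]_(p, q) -> Prop :=
  LinearSyzygies p q r (g : 'M_(p, q)) (A : 'M_(r, p)) :
    homog_mx 1 A -> A *m g = 0 -> syzygy_exact A g ->
    linear_syzygies A -> linear_syzygies g.

Lemma linear_syzygiesE (p q : nat) (g : 'M[S]_(p, q)) :
  linear_syzygies g ->
  exists r (A : 'M[S]_(r, p)),
    [/\ homog_mx 1 A, A *m g = 0, syzygy_exact A g & linear_syzygies A].
Proof. by case=> {}p {}q r {}g A h1 h2 h3 h4; exists r, A. Qed.

Lemma linear_syzygies_coind (P : forall p q, 'M[S]_(p, q) -> Prop) :
  (forall p q (g : 'M_(p, q)), P p q g ->
     exists r (A : 'M_(r, p)),
       [/\ homog_mx 1 A, A *m g = 0, syzygy_exact A g & P r p A]) ->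
  forall p q (g : 'M_(p, q)), P p q g -> linear_syzygies g.
Proof.
intros step; cofix IH; intros p q g Pg.
destruct (step p q g Pg) as [r [A [h1 h2 h3 h4]]].
exact (LinearSyzygies h1 h2 h3 (IH _ _ _ h4)).
Qed.

Lemma linear_syzygies0 (q : nat) (g : 'M[S]_(0, q)) : linear_syzygies g.
Proof.
apply: (@linear_syzygies_coind (fun p q _ => p = 0%N)) => // {q g}.
move=> p q g ep; move: ep g => -> g.
exists 0%N, 0; split=> //; [exact: homog_mx0|exact: mul0mx|].
by move=> v _; exists 0; rewrite !thinmx0 // mul0mx.
Qed.

(** The shape shared by the later differentials of a mapping cone, with [f] the chain map up to
    sign; it serves as the coinductive invariant. *)
Inductive linear_cone : forall p q : nat, 'M[S]_(p, q) -> Prop :=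
  LinearCone p1 p2 q1 q2 (A : 'M_(p1, q1)) (f : 'M_(p2, q1)) (B : 'M_(p2, q2)) :
    homog_mx 1 A -> homog_mx 1 f -> linear_syzygies A -> linear_syzygies B ->
    (forall v : 'rV_p2, v *m B = 0 -> exists u : 'rV_p1, u *m A = v *m f) ->
    linear_cone (block_mx A 0 f B).

(* The mapping cone of a chain map with linear entries between two linear
   complexes; the last hypothesis of [LinearCone] lets the chain map be lifted
   one step further. *)
Lemma linear_syzygies_cone (p q : nat) (g : 'M[S]_(p, q)) :
  linear_cone g -> linear_syzygies g.
Proof.
apply: linear_syzygies_coind => {p q g}.
move=> _ _ _ [p1 p2 q1 q2 A f B hA hf sA sB ext].
have [r1 [A' [hA' A'A exA sA']]] := linear_syzygiesE sA.
have [r2 [B' [hB' B'B exB sB']]] := linear_syzygiesE sB.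
(* The sign makes the off-diagonal block [f' *m A + B' *m f] of the product vanish. *)
have [|i|f' hf' f'A] := @homog_lift 1 1 _ _ _ A (- (B' *m f)) hA.
- by apply: homog_mxN; apply: (@homog_mxM 1 1).
- have [|u hu] := ext (- row i B').
    by rewrite mulNmx -row_mul B'B row0 oppr0.
  by exists u; rewrite hu mulNmx -row_mul linearN.
exists (r1 + r2)%N, (block_mx A' 0 f' B'); split.
- by apply: homog_block_mx => //; apply: homog_mx0.
- rewrite mulmx_block !mulmx0 !mul0mx A'A B'B !addr0 f'A addNr.
  exact: block_mx0.
- move=> v; rewrite -[v]hsubmxK mul_row_block !mulmx0 add0r.
  rewrite -[RHS]row_mx0 => /eq_row_mx[e1 e2].
  have [w ew] := exB _ e2.
  have [|w' ew'] := exA (lsubmx v - w *m f').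
    by rewrite mulmxBl -mulmxA f'A mulmxN opprK mulmxA ew.
  by exists (row_mx w' w); rewrite mul_row_block mulmx0 add0r ew ew' subrK.
(* If [v *m B' = 0], then [v *m f' *m A = - v *m B' *m f = 0], and exactness at [A] provides the
   next lift. *)
- apply: LinearCone => // v e; apply: exA.
  by rewrite -mulmxA f'A mulmxN mulmxA e mul0mx oppr0.
Qed.

(** The degree stays general: edge ideals need 2, their colon ideals need 1. *)
Definition linear_ideal (k : nat) (J : S -> Prop) : Prop :=
  exists p (g : 'cV[S]_p),
    [/\ homog_mx k g,
        forall q, J q <-> exists v : 'rV_p, (v *m g) 0 0 = q
      & linear_syzygies g].

Lemma linear_ideal_ext (k : nat) (J K : S -> Prop) :
  (forall q, J q <-> K q) -> linear_ideal k J -> linear_ideal k K.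
Proof.
by move=> e [p [g [hg hJ sg]]]; exists p, g; split=> // q; rewrite -e.
Qed.

Lemma linear_ideal0 (k : nat) : linear_ideal k (eq 0).
Proof.
exists 0%N, 0; split; [exact: homog_mx0| |exact: linear_syzygies0].
move=> q; split=> [<-|[v <-]]; last by rewrite mulmx0 mxE.
by exists 0; rewrite mul0mx mxE.
Qed.

(* The mapping cone of multiplication by [f] from S/(J : f) to S/J. *)
Lemma linear_ideal_add (k : nat) (J : S -> Prop) (f : S) :
  linear_ideal k J -> f \is k.-homog ->
  linear_ideal 1 (fun q => J (q * f)) ->
  linear_ideal k (fun q => exists r, J (q - r * f)).
Proof.
move=> [p [g [hg hJ sg]]] hf [p2 [h [hh hC sh]]].
(* The entries of [h] lie in the colon ideal, so multiplication by [f] carries them into [J] and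
   lifts to a linear matrix [phi]. *)
have [|i|phi hphi ephi] := @homog_lift 1 k _ _ _ g (- (h *m f%:M)) hg.
- apply: homog_mxN; apply: homog_mxM => // i j; rewrite mxE.
  by case: eqP => _; rewrite ?mulr1n ?mulr0n ?rpred0.
- have /hC/hJ[v ev] : exists v : 'rV_p2, (v *m h) 0 0 = - h i 0.
    by exists (- delta_mx 0 i); rewrite mulNmx -rowE !mxE.
  exists v; apply/rowP => j; rewrite ord1 ev !mxE big_ord1 !mxE mulr1n.
  by rewrite mulNr.
have [r [A [hA Ag exA sA]]] := linear_syzygiesE sg.
exists (p + 1)%N, (col_mx g f%:M); split.
- move=> i j; case: (split_ordP i) => i' ->; rewrite ?col_mxEu ?col_mxEd //.
  by rewrite !ord1 mxE mulr1n.
- move=> q; split=> [[u /hJ[v ev]]|[v ev]].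
    exists (row_mx v u%:M).
    by rewrite mul_row_col -scalar_mxM mxE ev mxE eqxx mulr1n subrK.
  exists (rsubmx v 0 0); apply/hJ; exists (lsubmx v).
  apply/eqP; rewrite eq_sym subr_eq -ev -[v in v *m _]hsubmxK mul_row_col.
  by rewrite mul_mx_scalar mxE [X in _ + X]mxE mulrC.
(* The syzygies of the enlarged system are those of [g] and, for each generator of the colon ideal,
   one having it as coefficient of [f]. *)
- apply: (@LinearSyzygies _ _ _ _ (block_mx A 0 phi h)).
  + by apply: homog_block_mx => //; apply: homog_mx0.
  + by rewrite mul_block_col Ag mul0mx addr0 ephi addNr col_mx0.
  + move=> v; rewrite -[v]hsubmxK mul_row_col => e.
    have /hC[w ew] : J (rsubmx v 0 0 * f).
      apply/hJ; exists (- lsubmx v); rewrite mulNmx.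
      move/matrixP/(_ 0 0): e; rewrite mul_mx_scalar mxE [X in _ + X]mxE mulrC.
      rewrite [RHS]mxE => /eqP; rewrite addrC addr_eq0 => /eqP ->.
      by rewrite [LHS]mxE.
    have {}ew : w *m h = rsubmx v by apply/rowP => j; rewrite !ord1.
    have [|w' ew'] := exA (lsubmx v - w *m phi).
      by rewrite mulmxBl -mulmxA ephi mulmxN opprK mulmxA ew.
    by exists (row_mx w' w); rewrite mul_row_block mulmx0 add0r ew ew' subrK.
  + apply: linear_syzygies_cone; apply: LinearCone => // v e; apply: exA.
    by rewrite -mulmxA ephi mulmxN mulmxA e mul0mx oppr0.
Qed.

Lemma linear_ideal_resolution (e : rel 'I_n) :
  linear_ideal 2 (in_edge_ideal F n e) -> has_linear_resolution F n e.
Proof.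
case=> p [g [hg hJ sg]].
(* Each stage only asserts that a next matrix exists, whereas a resolution is a sequence; choice
   selects a successor of every stage, sizes included. *)
pose stage := {q : nat & {p : nat & {A : 'M[S]_(p, q) | linear_syzygies A}}}.
pose width (s : stage) := projT1 s.
pose height (s : stage) := projT1 (projT2 s).
pose mx (s : stage) : 'M_(height s, width s) := sval (projT2 (projT2 s)).
have step (s : stage) : {t : {r : nat & 'M[S]_(r, height s)} |
    [/\ homog_mx 1 (projT2 t), projT2 t *m mx s = 0,
        syzygy_exact (projT2 t) (mx s) & linear_syzygies (projT2 t)]}.
  apply: constructive_indefinite_description.
  have [r [A hA]] := linear_syzygiesE (proj2_sig (projT2 (projT2 s))).
  by exists (existT _ r A).
pose next (s : stage) : stage :=
  existT _ (height s) (existT _ (projT1 (sval (step s)))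
    (exist _ (projT2 (sval (step s))) (let: And4 _ _ _ h := svalP (step s) in h))).
pose st i := iter i next (existT _ 1%N (existT _ p (exist _ g sg))).
(* Stage 0 is the column of generators, so differential [i] is the matrix of stage [i.+1]. *)
exists (fun i => height (st i)), g, (fun i => mx (st i.+1)); split=> //.
- by move=> i; have [h _ _ _] := svalP (step (st i)).
- split=> [||i|i].
  + by have [_ h _ _] := svalP (step (st 0%N)).
  + by have [_ _ h _] := svalP (step (st 0%N)).
  + by have [_ h _ _] := svalP (step (st i.+1)).
  + by have [_ _ h _] := svalP (step (st i.+1)).
Qed.

End LinearResolutions.

(** * Monomial ideals and split graphs *)

Section MonomialIdeals.

Import GRing.Theory.
Local Open Scope ring_scope.

Variables (F : fieldType) (n : nat).
Local Notation S := {mpoly F[n]}.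
Local Notation linear_ideal := (@linear_ideal F n).

(** For [P] the set of monomials of a monomial ideal this is membership in it; colon by a monomial
    and adding a monomial become operations on [P]. *)
Definition monomial_ideal (P : pred 'X_{1..n}) (q : S) : Prop :=
  {in msupp q, forall m, P m}.

Lemma linear_monomial_ext (k : nat) (P Q : pred 'X_{1..n}) :
  P =1 Q -> linear_ideal k (monomial_ideal P) ->
  linear_ideal k (monomial_ideal Q).
Proof.
by move=> e; apply: linear_ideal_ext => q; split=> h m /h; rewrite e.
Qed.

Lemma linear_monomial0 (k : nat) : linear_ideal k (monomial_ideal pred0).
Proof.
apply: (linear_ideal_ext _ (linear_ideal0 F n k)) => q; split=> [<- m|].
  by rewrite msupp0.
rewrite /monomial_ideal => h; apply/eqP; rewrite eq_sym -msupp_eq0.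
by case: (msupp q) h => // m s /(_ m (mem_head _ _)).
Qed.

Lemma monomial_ideal_colon (P : pred 'X_{1..n}) (u : 'X_{1..n}) (q : S) :
  monomial_ideal P (q * 'X_[u]) <-> monomial_ideal (fun m => P (u + m)%MM) q.
Proof.
split=> h m hm; last first.
  by move: hm; rewrite (perm_mem (msuppMX _ _)) => /mapP[m' /h hm' ->].
by apply: h; rewrite (perm_mem (msuppMX _ _)) map_f.
Qed.

Lemma monomial_ideal_add (P : pred 'X_{1..n}) (u : 'X_{1..n}) (q : S) :
  (exists r, monomial_ideal P (q - r * 'X_[u])) <->
  monomial_ideal (fun m => (u <= m)%MM || P m) q.
Proof.
split=> [[r h] m hm|h].
  case: (boolP (u <= m)%MM) => //= nle; apply: h; move: hm.
  rewrite !mcoeff_msupp mcoeffB (_ : (r * 'X_[u])@_m = 0) ?subr0 //.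
  apply/eqP; rewrite mcoeff_eq0 (perm_mem (msuppMX _ _)).
  by apply: contra nle => /mapP[m' _ ->]; apply: lem_addr.
(* The multiplier gathers all terms of [q] divisible by ['X_[u]], each divided by it. *)
exists (\sum_(m <- msupp q | (u <= m)%MM) q@_m *: 'X_[m - u]) => m.
have -> : q - (\sum_(m <- msupp q | (u <= m)%MM) q@_m *: 'X_[m - u]) * 'X_[u]
   = \sum_(m <- msupp q | ~~ (u <= m)%MM) q@_m *: 'X_[m].
  rewrite {1}[q]mpolyE (bigID (fun m => (u <= m)%MM)) /= mulr_suml addrAC.
  rewrite [X in X + _](_ : _ = 0) ?add0r // -sumrB big1 // => m' le_um.
  by rewrite -scalerAl -mpolyXD submK // subrr.
move=> hm; have [m'] : exists m', [&& m' \in msupp q, ~~ (u <= m')%MM & m == m'].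
  move: hm; rewrite mcoeff_msupp raddf_sum /= => nz.
  case: (boolP (has (fun m' => ~~ (u <= m')%MM && (m == m')) (msupp q))).
    by case/hasP => m' h1 h2; exists m'; rewrite h1.
  move/hasPn => hn; case/eqP: nz; rewrite big_seq_cond big1 // => m'.
  case/andP => /hn; rewrite negb_and negbK => /orP[->//|ne] _.
  by rewrite mcoeffZ mcoeffX eq_sym (negbTE ne) mulr0.
by case/and3P => /h /orP[->//|Pm] _ /eqP ->.
Qed.

Lemma linear_monomial_add (k : nat) (P : pred 'X_{1..n}) (u : 'X_{1..n}) :
  mdeg u = k -> linear_ideal k (monomial_ideal P) ->
  linear_ideal 1 (monomial_ideal (fun m => P (u + m)%MM)) ->
  linear_ideal k (monomial_ideal (fun m => (u <= m)%MM || P m)).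
Proof.
move=> du hP hC; apply: linear_ideal_ext (fun q => monomial_ideal_add P u q) _.
apply: linear_ideal_add => //; first by rewrite dhomogX; apply/eqP.
by apply: (linear_ideal_ext _ hC) => q; rewrite monomial_ideal_colon.
Qed.

(** A new variable is a nonzerodivisor modulo the ideal of the others, so the colon ideal is that
    ideal itself and the induction hypothesis serves both inputs of the mapping cone. *)
Lemma linear_variable_ideal (s : seq 'I_n) :
  linear_ideal 1 (monomial_ideal (fun m => has (fun i => m i != 0%N) s)).
Proof.
elim: s => [|i s IH]; first exact: linear_monomial0.
have [is_s|ni] := boolP (i \in s).
  apply: (linear_monomial_ext _ IH) => m /=; case: (boolP (m i != 0%N)) => //= mi.
  by apply/hasP; exists i.
apply: (@linear_monomial_ext _ (fun m => (U_(i) <= m)%MM ||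
    has (fun i => m i != 0%N) s)); first by move=> m /=; rewrite lep1mP.
apply: linear_monomial_add => //; first by rewrite mdeg1.
apply: (linear_monomial_ext _ IH) => m; apply: eq_in_has => j js.
rewrite mnmDE mnm1E (_ : (i == j) = false) //.
by apply: contraNF ni => /eqP ->.
Qed.

Implicit Types (E : seq ('I_n * 'I_n)) (K : seq 'I_n).

(** Edges form a list so that they can be added one at a time. The test means divisibility by the
    edge monomial only when the two ends differ, hence [loopless] below. *)
Definition edge_monomials E : pred 'X_{1..n} :=
  fun m => has (fun p => (m p.1 != 0%N) && (m p.2 != 0%N)) E.

Definition joined E (x y : 'I_n) := ((x, y) \in E) || ((y, x) \in E).

Definition loopless E := all (fun p => p.1 != p.2) E.

Definition touches K (p : 'I_n * 'I_n) := (p.1 \in K) || (p.2 \in K).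

Definition clique_of E K :=
  {in K &, forall x y, x != y -> joined E x y}.

Lemma joinedC E x y : joined E x y = joined E y x.
Proof. exact: orbC. Qed.

Lemma pair_lepE (a b : 'I_n) (m : 'X_{1..n}) : a != b ->
  (U_(a) + U_(b) <= m)%MM = (m a != 0%N) && (m b != 0%N).
Proof.
move=> ne; apply/mnm_lepP/andP => [h|[ha hb] i].
  split; [have:= h a|have := h b]; rewrite mnmDE !mnm1E eqxx -lt0n.
    exact: leq_trans.
  by rewrite addnC; apply: leq_trans.
rewrite mnmDE !mnm1E; have [<-|_] := eqVneq a i.
  by rewrite eq_sym (negbTE ne) lt0n.
by have [<-|_] := eqVneq b i; rewrite ?lt0n.
Qed.

(** The colon ideal by x_a x_b is generated by the neighbours of [a] and [b]: an edge disjoint from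
    ab contributes only x_c x_d, and by hypothesis one of its ends is such a neighbour. *)
Lemma linear_add_edge E (a b : 'I_n) :
  a != b -> loopless E ->
  (forall c d, (c, d) \in E -> c \notin [:: a; b] -> d \notin [:: a; b] ->
     [|| joined E a c, joined E b c, joined E a d | joined E b d]) ->
  linear_ideal 2 (monomial_ideal (edge_monomials E)) ->
  linear_ideal 2 (monomial_ideal (edge_monomials ((a, b) :: E))).
Proof.
move=> ne_ab /allP ll far linE; have [j_ab|nj_ab] := boolP (joined E a b).
  apply: (linear_monomial_ext _ linE) => m; rewrite /edge_monomials /=.
  case: (boolP (_ && _)) => //= h; apply/hasP.
  by case/orP: j_ab => h'; [exists (a, b)|exists (b, a); rewrite 1?andbC].
apply: (@linear_monomial_ext _
  (fun m => (U_(a) + U_(b) <= m)%MM || edge_monomials E m)).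
  by move=> m /=; rewrite pair_lepE.
apply: linear_monomial_add => //; first by rewrite mdegD !mdeg1.
pose L := [seq v <- enum 'I_n | (v \notin [:: a; b]) &&
             (joined E a v || joined E b v)].
apply: (linear_monomial_ext _ (linear_variable_ideal L)) => m.
have off (v : 'I_n) : v \notin [:: a; b] -> ((U_(a) + U_(b) + m)%MM v = m v).
  rewrite !inE negb_or !mnmDE !mnm1E => /andP[va vb].
  by rewrite ![_ == v]eq_sym (negbTE va) (negbTE vb).
have on (v : 'I_n) : v \in [:: a; b] -> ((U_(a) + U_(b) + m)%MM v != 0%N).
  rewrite !inE !mnmDE !mnm1E ![v == _]eq_sym.
  by case/orP => ->; rewrite ?addn1 ?add1n ?addnS ?addSn.
have nl x : ~~ joined E x x.
  by rewrite /joined orbb; apply/negP => /ll; rewrite eqxx.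
have sub x y : joined E x y -> x \in [:: a; b] -> y \notin [:: a; b].
  move=> jxy; rewrite !inE negb_or => /orP[]/eqP ex; rewrite {x}ex in jxy.
    by apply/andP; split; apply: contraTneq jxy => ->.
  by apply/andP; split; apply: contraTneq jxy => ->; rewrite 1?joinedC.
have inL x y : joined E x y -> x \in [:: a; b] -> y \in L.
  move=> jxy hx; rewrite mem_filter mem_enum andbT (sub _ _ jxy hx) /=.
  by move: hx; rewrite !inE => /orP[]/eqP<-; rewrite jxy ?orbT.
apply/hasP/hasP => [[v]|[[c d] cdE /= /andP[hc hd]]].
  rewrite mem_filter => /andP[/andP[vab adj] _] mv.
  have [w w_ab jwv] : exists2 w, w \in [:: a; b] & joined E w v.
    by case/orP: adj => j; [exists a|exists b]; rewrite // !inE eqxx ?orbT.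
  have hw := on _ w_ab.
  by case/orP: jwv => h; [exists (w, v)|exists (v, w)] => //=;
    rewrite (off v vab) mv hw.
have jcd : joined E c d by rewrite /joined cdE.
have [cab|cab] := boolP (c \in [:: a; b]).
  by exists d; rewrite -?off ?(inL c) ?(sub c).
have [dab|dab] := boolP (d \in [:: a; b]).
  by exists c; rewrite -?off // (inL d) // joinedC.
rewrite off // in hc; rewrite off // in hd.
have aa : a \in [:: a; b] by rewrite !inE eqxx.
have bb : b \in [:: a; b] by rewrite !inE eqxx orbT.
by case/or4P: (far c d cdE cab dab) => j;
  [exists c => //; apply: inL j aa|exists c => //; apply: inL j bb
  |exists d => //; apply: inL j aa|exists d => //; apply: inL j bb].
Qed.

(** Two disjoint edges that touch [K] are linked by a clique edge, which is present in [E] from the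
    start. *)
Lemma linear_add_edges E K (R : seq ('I_n * 'I_n)) :
  loopless E -> clique_of E K -> all (touches K) E ->
  loopless R -> all (touches K) R ->
  linear_ideal 2 (monomial_ideal (edge_monomials E)) ->
  linear_ideal 2 (monomial_ideal (edge_monomials (R ++ E))).
Proof.
move=> llE clK tE + + linE; elim: R => //= [[a b] R] IH /andP[ne llR] /andP[tab tR].
apply: linear_add_edge => //; last exact: IH.
  by rewrite /loopless all_cat; apply/andP.
have clK' x y : x \in K -> y \in K -> x != y -> joined (R ++ E) x y.
  move=> hx hy nxy; move: (clK x y hx hy nxy).
  by rewrite /joined !mem_cat => /orP[]->; rewrite !orbT.
move=> c d cd; rewrite !inE !negb_or => /andP[ca cb] /andP[da db].
have : touches K (c, d).
  by move: cd; rewrite mem_cat => /orP[/(allP tR)|/(allP tE)].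
by case/orP: tab => /= hab /orP[]/= hcd; apply/or4P;
  [apply: Or41|apply: Or43|apply: Or42|apply: Or44];
  apply: clK' => //; rewrite eq_sym.
Qed.

Fixpoint clique_edges K : seq ('I_n * 'I_n) :=
  if K is x :: K' then [seq (x, y) | y <- K'] ++ clique_edges K' else [::].

Lemma clique_edgesP K (p : 'I_n * 'I_n) :
  uniq K -> p \in clique_edges K -> [&& p.1 \in K, p.2 \in K & p.1 != p.2].
Proof.
elim: K => //= x K IH /andP[xK uK]; rewrite mem_cat => /orP[/mapP[y yK ->]|] /=.
  by rewrite !inE eqxx yK orbT /=; apply: contraNneq xK => ->.
by case/(IH uK)/and3P => h1 h2 h3; rewrite !inE h1 h2 h3 !orbT.
Qed.

Lemma clique_of_clique_edges K : clique_of (clique_edges K) K.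
Proof.
elim: K => //= x K IH y z; rewrite !inE /joined !mem_cat.
case/predU1P => [->|yK] /predU1P[->|zK]; first by rewrite eqxx.
- by move=> _; rewrite map_f.
- by move=> _; rewrite (map_f (pair x) yK) !orbT.
- by move=> /(IH y z yK zK)/orP[]->; rewrite !orbT.
Qed.

(** The edges from a new vertex to a smaller clique all touch that clique, so they can be added one
    by one. *)
Lemma linear_clique_edges K : uniq K ->
  linear_ideal 2 (monomial_ideal (edge_monomials (clique_edges K))).
Proof.
elim: K => [_|x K IH /= /andP[xK uK]]; first exact: linear_monomial0.
apply: (@linear_add_edges _ K) (IH uK).
- by apply/allP => p /(clique_edgesP uK)/and3P[].
- exact: clique_of_clique_edges.
- by apply/allP => p /(clique_edgesP uK)/and3P[h _ _]; rewrite /touches h.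
- by apply/allP => p /mapP[y yK ->] /=; apply: contraNneq xK => ->.
- by apply/allP => p /mapP[y yK ->]; rewrite /touches /= yK orbT.
Qed.

Lemma in_edge_idealE (e : rel 'I_n) (q : S) : irreflexive e ->
  in_edge_ideal F n e q <->
  monomial_ideal (edge_monomials [seq p <- enum {: 'I_n * 'I_n} | e p.1 p.2]) q.
Proof.
move=> irr; split=> [[c ->] m|hq].
  rewrite mcoeff_msupp raddf_sum /= => nz.
  have [u hu] : exists u,
      (\sum_(v | e u v) c u v * ('X_u * 'X_v))@_m != 0.
    by apply/existsP; apply: contraNT nz => /existsPn h;
      rewrite big1 // => u _; apply/eqP/negPn/h.
  have [v] : exists v, e u v && ((c u v * ('X_u * 'X_v))@_m != 0).
    apply/existsP; apply: contraNT hu => /existsPn h.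
    rewrite raddf_sum big1 // => v euv; apply/eqP/negPn.
    by have := h v; rewrite euv.
  case/andP => euv; rewrite -mpolyXD -mcoeff_msupp (perm_mem (msuppMX _ _)).
  case/mapP => m' _ ->; apply/hasP; exists (u, v).
    by rewrite mem_filter mem_enum euv.
  rewrite -pair_lepE; first exact: lem_addr.
  by apply/eqP => /= uv; move: euv; rewrite uv irr.
pose G := [seq p <- enum {: 'I_n * 'I_n} | e p.1 p.2].
have pickP' (m : 'X_{1..n}) : m \in msupp q -> {p : 'I_n * 'I_n |
    e p.1 p.2 & (U_(p.1) + U_(p.2) <= m)%MM}.
  move=> /hq /hasP/sig2W[[u v]]; rewrite mem_filter /= => /andP[euv _] h.
  exists (u, v) => //=; rewrite pair_lepE //.
  by apply/eqP => /= uv; move: euv; rewrite uv irr.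
have ideal0 : in_edge_ideal F n e 0.
  by exists (fun _ _ => 0); rewrite big1 // => u _; rewrite big1 // => v _; rewrite mul0r.
have idealD p r : in_edge_ideal F n e p -> in_edge_ideal F n e r ->
    in_edge_ideal F n e (p + r).
  move=> [c ->] [c' ->]; exists (fun u v => c u v + c' u v).
  rewrite -big_split; apply: eq_bigr => u _ /=; rewrite -big_split.
  by apply: eq_bigr => v _ /=; rewrite mulrDl.
rewrite [q]mpolyE big_seq; apply: big_ind => // m /pickP'[[u v] /= euv le].
(* Each term of [q] is charged to a single edge whose monomial divides it. *)
exists (fun u' v' => if (u' == u) && (v' == v) then q@_m *: 'X_[m - (U_(u) + U_(v))]
                     else 0).
rewrite (bigD1 u) //= [X in _ + X]big1 => [|u' nu]; last first.
  by rewrite big1 // => v' _; rewrite (negbTE nu) mul0r.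
rewrite (bigD1 v) //= [X in _ + X + _]big1 => [|v' /andP[_ nv]]; last first.
  by rewrite (negbTE nv) andbF mul0r.
by rewrite !eqxx /= !addr0 -mpolyXD -scalerAl -mpolyXD submK.
Qed.

Lemma split_graph_linear (e : rel 'I_n) (K : {set 'I_n}) :
  ssrbool.symmetric e -> irreflexive e ->
  {in K &, forall x y, x != y -> e x y} ->
  (forall x y, e x y -> (x \in K) || (y \in K)) ->
  has_linear_resolution F n e.
Proof.
move=> sym irr clK cov; apply: linear_ideal_resolution.
apply: linear_ideal_ext (fun q => iff_sym (in_edge_idealE q irr)) _.
set G := [seq p <- _ | _].
(* The clique edges already belong to the graph; listing them once more at the end of the list lets
   them be added first. *)
apply: (@linear_monomial_ext _ (edge_monomials (G ++ clique_edges (enum K)))).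
  move=> m; rewrite /edge_monomials has_cat; apply/orb_idr => /hasP[p].
  case/(clique_edgesP (enum_uniq _))/and3P; rewrite !mem_enum => h1 h2 h3 h4.
  by apply/hasP; exists p => //; rewrite mem_filter mem_enum andbT clK.
apply: (@linear_add_edges _ (enum K)).
- by apply/allP => p /(clique_edgesP (enum_uniq _))/and3P[].
- exact: clique_of_clique_edges.
- by apply/allP => p /(clique_edgesP (enum_uniq _))/and3P[h _ _]; rewrite /touches h.
- apply/allP => p; rewrite mem_filter => /andP[h _].
  by apply/eqP => pp; move: h; rewrite pp irr.
- apply/allP => p; rewrite mem_filter => /andP[h _].
  by rewrite /touches !mem_enum cov.
- exact/linear_clique_edges/enum_uniq.
Qed.

End MonomialIdeals.

(** * Gaps obstruct linear resolutions *)

Section GapObstruction.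

Import GRing.Theory.
Local Open Scope ring_scope.

Variables (F : fieldType) (n : nat).
Local Notation S := {mpoly F[n]}.

Lemma mcoeffXM (u : 'X_{1..n}) (q : S) (m : 'X_{1..n}) :
  ('X_[u] * q)@_m = if (u <= m)%MM then q@_(m - u) else 0.
Proof.
rewrite mulrC; case: ifP => [le|nle].
  by rewrite -{1}(submK le) addmC mcoeffMX.
apply/eqP; rewrite mcoeff_eq0 (perm_mem (msuppMX _ _)); apply/negP.
by case/mapP => m' _ e; rewrite e lem_addr in nle.
Qed.

Lemma linear_formE (p : S) : p \is 1.-homog -> p = \sum_i p@_U_(i) *: 'X_i.
Proof.
move=> hp; apply/mpolyP => m; rewrite raddf_sum /=.
have [/mdeg1P[i /eqP ->]|nm] := boolP (mdeg m == 1%N).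
  rewrite (bigD1 i) //= big1 ?addr0 => [|j ne]; rewrite mcoeffZ mcoeffXU.
    by rewrite eqxx mulr1.
  by rewrite (negbTE ne) mulr0.
rewrite (dhomog_nemf_coeff hp nm) big1 // => i _.
rewrite mcoeffZ mcoeffX; case: eqP => [e|]; last by rewrite mulr0.
by rewrite -e mdeg1 eqxx in nm.
Qed.

Lemma mcoeff_linear_formM (p q : S) (m : 'X_{1..n}) : p \is 1.-homog ->
  (p * q)@_m = \sum_i p@_U_(i) * ('X_i * q)@_m.
Proof.
move=> hp; rewrite {1}(linear_formE hp) mulr_suml raddf_sum /=.
by apply: eq_bigr => i _; rewrite -scalerAl mcoeffZ.
Qed.

(** In the degree of [q] only the constant term of [p] can contribute. *)
Lemma mcoeffM_homog (d : nat) (p q : S) (m : 'X_{1..n}) :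
  q \is d.-homog -> mdeg m = d -> (p * q)@_m = p@_0%MM * q@_m.
Proof.
move=> hq dm; have term (m' : 'X_{1..n}) : ('X_[m'] * q)@_m = (m' == 0%MM)%:R * q@_m.
  rewrite mcoeffXM; case: eqP => [->|/eqP ne].
    by rewrite subm0 mul1r (_ : (0 <= m)%MM) //; apply/mnm_lepP => i; rewrite mnm0E.
  rewrite mul0r; case: ifP => // le; apply: dhomog_nemf_coeff hq _.
  rewrite -dm -(submK le) mdegD addmK neq_ltn -[X in (X < _)%N]addn0 ltn_add2l.
  by rewrite lt0n mdeg_eq0 ne.
rewrite {1}[p]mpolyE mulr_suml raddf_sum /=.
rewrite (eq_bigr (fun m' => p@_m' * (m' == 0%MM)%:R * q@_m)) => [|m' _].
  rewrite -mulr_suml; congr (_ * _); have [p0|p0] := boolP (0%MM \in msupp p).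
    rewrite (bigD1_seq 0%MM) //= eqxx mulr1 big1 ?addr0 // => m' ne.
    by rewrite (negbTE ne) mulr0.
  rewrite memN_msupp_eq0 // big_seq big1 // => m' hm'.
  by case: eqP => [e|]; rewrite ?mulr0 //; rewrite -e hm' in p0.
by rewrite -scalerAl mcoeffZ term mulrA.
Qed.

Lemma in_edge_ideal_mcoeff (e : rel 'I_n) (q : S) (a b : 'I_n) :
  irreflexive e -> in_edge_ideal F n e q -> ~~ e a b -> ~~ e b a ->
  q@_(U_(a) + U_(b)) = 0.
Proof.
move=> irr /(in_edge_idealE _ irr) hq nab nba; apply/eqP; rewrite mcoeff_eq0.
apply/negP => /hq/hasP[[u v]]; rewrite mem_filter /= => /andP[euv _].
have mE i : ((U_(a) + U_(b))%MM i != 0%N) = (i == a) || (i == b).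
  by rewrite mnmDE !mnm1E addn_eq0 !eqb0 negb_and !negbK ![i == _]eq_sym.
rewrite !mE => /andP[/orP[]/eqP eu /orP[]/eqP ev]; move: euv; rewrite eu ev ?irr //.
- by rewrite (negbTE nab).
- by rewrite (negbTE nba).
Qed.

(* Applied to the terms [l * q] of a linear syzygy of the generators: in the
   multidegree x_i x_a x_b only the part of [q] along x_a x_b contributes. *)
Lemma linear_syzygy_mcoeff (e : rel 'I_n) (q l : S) (i a b : 'I_n) :
  irreflexive e -> in_edge_ideal F n e q -> l \is 1.-homog ->
  ~~ e i a -> ~~ e a i -> ~~ e i b -> ~~ e b i ->
  (l * q)@_(U_(i) + (U_(a) + U_(b))) = l@_U_(i) * q@_(U_(a) + U_(b)).
Proof.
move=> irr hq hl n1 n2 n3 n4.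
rewrite mcoeff_linear_formM // (bigD1 i) //= mulrC big1 ?addr0.
  by rewrite [in X in X * _]mulrC mcoeffMX mulrC.
move=> j ne; rewrite mulrC; apply/eqP; rewrite mulf_eq0; apply/orP; left.
have [->|nja] := eqVneq j a.
  rewrite addmA [(U_(i) + _)%MM]addmC -addmA mulrC mcoeffMX; apply/eqP.
  exact: in_edge_ideal_mcoeff irr hq _ _.
have [->|njb] := eqVneq j b.
  rewrite [(U_(a) + _)%MM]addmC addmA [(U_(i) + _)%MM]addmC -addmA.
  rewrite mulrC mcoeffMX; apply/eqP.
  exact: in_edge_ideal_mcoeff irr hq _ _.
rewrite mcoeffXM lep1mP !mnmDE !mnm1E.
by rewrite ![_ == j]eq_sym (negbTE ne) (negbTE nja) (negbTE njb).
Qed.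

Lemma linear_resolution_gap (e : rel 'I_n) (a b c d : 'I_n) :
  irreflexive e -> ssrbool.symmetric e -> has_linear_resolution F n e ->
  e a b -> e c d -> a != c -> a != d -> b != c -> b != d ->
  [|| e a c, e a d, e b c | e b d].
Proof.
move=> irr sym [r [g [A [hg hI hA [Ag exA _ _]]]]] eab ecd ac ad bc bd.
apply: contraT; rewrite !negb_or => /and4P[nac nad nbc nbd].
have neq x y : e x y -> x != y by apply: contraTneq => ->; rewrite irr.
have ab := neq _ _ eab; have cd := neq _ _ ecd.
have gI k : in_edge_ideal F n e (g k 0).
  by apply/hI; exists (delta_mx 0 k); rewrite -rowE mxE.
have edgeI x y : e x y -> in_edge_ideal F n e ('X_x * 'X_y).
  move=> exy; apply/in_edge_idealE => // m.
  rewrite -mpolyXD => /mem_msuppXP <-; apply/hasP; exists (x, y).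
    by rewrite mem_filter mem_enum exy.
  by rewrite -pair_lepE ?lepm_refl ?neq.
have [v ev] := (hI _).1 (edgeI _ _ eab).
have [w ew] := (hI _).1 (edgeI _ _ ecd).
(* The Koszul syzygy of x_a x_b and x_c x_d, written in the given generators. *)
pose s := 'X_[U_(c) + U_(d)] *: v - 'X_[U_(a) + U_(b)] *: w.
have [|u us] := exA s.
  apply/rowP => i; rewrite ord1 mulmxBl -!scalemxAl mxE [X in _ + X]mxE.
  rewrite mxE [X in _ - X]mxE ev ew !mpolyXD mulrC subrr.
  by rewrite mxE.
(* This functional extracts the part of a syzygy with coefficient x_c x_d along x_a x_b. It is 1 on
   the Koszul syzygy and will vanish on combinations of linear ones. *)
pose phi (t : 'rV[S]_(r 0%N)) :=
  \sum_k (t 0 k)@_(U_(c) + U_(d)) * (g k 0)@_(U_(a) + U_(b)).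
have : phi s = 1.
  have <- : ('X_a * 'X_b : S)@_(U_(a) + U_(b)) = 1.
    by rewrite -mpolyXD mcoeffX eqxx.
  rewrite -ev mxE raddf_sum; apply: eq_bigr => k _ /=.
  rewrite (mcoeffM_homog _ (hg k)); last by rewrite mdegD !mdeg1.
  congr (_ * _); rewrite !mxE mcoeffB !mcoeffXM lepm_refl.
  rewrite -{1}[(U_(c) + U_(d))%MM]add0m addmK pair_lepE // !mnmDE !mnm1E.
  by rewrite ![_ == a]eq_sym (negbTE ac) (negbTE ad) subr0.
suff phi0 : phi (u *m A 0%N) = 0.
  by rewrite -us phi0 => /eqP; rewrite eq_sym oner_eq0.
(* Compare coefficients of x_i x_a x_b in row [j] of [A 0 *m g = 0]; without edges between ab and cd
   only the part along x_a x_b remains. *)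
have key j i : (i == c) || (i == d) ->
    \sum_k (A 0%N j k)@_U_(i) * (g k 0)@_(U_(a) + U_(b)) = 0.
  move=> hi; have := congr1 (fun M : 'cV[S]_(r 1%N) =>
    (M j 0)@_(U_(i) + (U_(a) + U_(b)))) Ag.
  rewrite /= !mxE raddf_sum /= mcoeff0 => e0; rewrite -[RHS]e0; apply: eq_bigr => k _.
  by rewrite (linear_syzygy_mcoeff irr (gI k)) //;
    case/orP: hi => /eqP->; rewrite 1?[e c _]sym 1?[e d _]sym 1?eq_sym.
rewrite /phi.
(* Splitting the entries of [A 0] into variables leaves only [i = c] and [i = d], the divisors of
   x_c x_d. *)
transitivity (\sum_j \sum_i ('X_i * u 0 j)@_(U_(c) + U_(d)) *
    \sum_k (A 0%N j k)@_U_(i) * (g k 0)@_(U_(a) + U_(b))).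
  rewrite (eq_bigr (fun k => \sum_j \sum_i ('X_i * u 0 j)@_(U_(c) + U_(d)) *
    ((A 0%N j k)@_U_(i) * (g k 0)@_(U_(a) + U_(b))))) => [|k _].
    rewrite exchange_big; apply: eq_bigr => j _; rewrite exchange_big.
    by apply: eq_bigr => i _; rewrite mulr_sumr.
  rewrite mxE raddf_sum mulr_suml; apply: eq_bigr => j _ /=.
  rewrite mulrC mulrC [u 0 j * _]mulrC mcoeff_linear_formM // mulr_suml.
  by apply: eq_bigr => i _; rewrite mulrA [X in X * _]mulrC.
rewrite big1 // => j _; rewrite big1 // => i _.
have [hi|] := boolP ((i == c) || (i == d)); first by rewrite key ?mulr0.
rewrite negb_or => /andP[ic id]; rewrite mcoeffXM lep1mP mnmDE !mnm1E.
by rewrite ![_ == i]eq_sym (negbTE ic) (negbTE id) mul0r.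
Qed.

End GapObstruction.

(** * Trees with gap-free square *)

Section TreeSquares.

Variables (V : finType) (e : rel V).
Hypothesis tree_e : is_tree e.

Local Notation sq := (graph_square e).

Let symE : ssrbool.symmetric e. Proof. by case: tree_e => -[]. Qed.
Let irrE : irreflexive e. Proof. by case: tree_e => -[]. Qed.
Let acyE : graph_acyclic e. Proof. by case: tree_e. Qed.
Let conE : graph_connected e. Proof. by case: tree_e. Qed.

Lemma edge_neq x y : e x y -> x != y.
Proof. by apply: contraTneq => ->; rewrite irrE. Qed.

Lemma sqC x y : sq x y = sq y x.
Proof.
rewrite /graph_square eq_sym symE; congr (_ && (_ || _)).
by apply: eq_existsb => z; rewrite andbC ![e z _]symE.
Qed.

Lemma sq_edge x y : e x y -> sq x y.
Proof. by move=> exy; rewrite /graph_square (edge_neq exy) exy. Qed.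

Lemma sq_common z x y : e z x -> e z y -> x != y -> sq x y.
Proof.
move=> zx zy ne; rewrite /graph_square ne /=; apply/orP; right.
by apply/existsP; exists z; rewrite symE zx.
Qed.

Lemma sqP x y :
  reflect (x != y /\ (e x y \/ exists2 z, e x z & e z y)) (sq x y).
Proof.
rewrite /graph_square; apply: (iffP andP) => -[ne h]; split=> //.
  by case/orP: h => [|/existsP[z /andP[]]]; [left|right; exists z].
by case: h => [->//|[z xz zy]]; apply/orP; right; apply/existsP; exists z; rewrite xz.
Qed.

Lemma path_last_nonadj x p :
  path e x p -> uniq (x :: p) -> 2 <= size p -> ~~ e (last x p) x.
Proof.
move=> px up sp; have := acyE (c := x :: p) sp up.
by rewrite /cycle rcons_path px.
Qed.

(** A common neighbour [z] of the ends closes a cycle: with the whole path if [z] lies off it,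
    otherwise with one of the two pieces at [z], one of which is long enough. *)
Lemma path_last_far x p :
  path e x p -> uniq (x :: p) -> 3 <= size p -> ~~ sq x (last x p).
Proof.
move=> px up sp; apply/sqP => -[ne [exl|[z xz zl]]].
  by have := path_last_nonadj px up (ltnW sp); rewrite symE exl.
have [zp|zp] := boolP (z \in x :: p); last first.
  have := @path_last_nonadj z (x :: p); rewrite /= symE xz px [e _ z]symE zl.
  by move=> /(_ isT); rewrite zp ltnS (ltnW (ltnW sp)) => /(_ up isT).
rewrite inE eq_sym (negbTE (edge_neq xz)) /= in zp.
case/splitPr: zp px up sp ne zl => p1 p2 + up sp _.
rewrite cat_path last_cat /= => /and3P[px1 lz pz2] zl.
have up1 : uniq (x :: rcons p1 z).
  by move: up; rewrite -[p1 ++ _]cat_rcons -cat_cons cat_uniq => /andP[].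
have up2 : uniq (z :: p2) by move: up; rewrite -cat_cons cat_uniq => /and3P[].
case: p1 => [|y p1] in px1 lz up1 up sp *.
  by have := path_last_nonadj pz2 up2; rewrite symE zl => /(_ sp).
have := @path_last_nonadj x (rcons (y :: p1) z).
by rewrite rcons_path px1 lz last_rcons symE xz size_rcons => /(_ isT up1 isT).
Qed.

Fixpoint nonbacktracking (s : seq V) : bool :=
  if s is x :: t then
    (if t is _ :: z :: _ then x != z else true) && nonbacktracking t
  else true.

(** The tail is simple by induction, so a return to [x] closes a cycle; returns after one or two
    steps contradict irreflexivity or nonbacktracking. Distinctness along a walk thus reduces to
    comparing vertices two steps apart. *)
Lemma nonbacktracking_uniq x p :
  path e x p -> nonbacktracking (x :: p) -> uniq (x :: p).
Proof.
elim: p x => // y p IH x pyp nb; have /andP[xy yp] := pyp; have /andP[_ rp] := nb.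
have up := IH y yp rp; rewrite cons_uniq up andbT.
apply/negP => xp; case/splitPr: xp up pyp nb => p1 p2.
rewrite cat_path cat_uniq /= negb_or => /and3P[u1 /andP[nx1 _] _] /and3P[pp1 lx _] nb.
case: p1 => [|y' [|z' p1]] in u1 nx1 pp1 lx nb *.
- by move: lx; rewrite /= irrE.
- by move: nb; rewrite /= eqxx.
have := @path_last_nonadj x (y' :: z' :: p1) pp1.
by rewrite lx cons_uniq nx1 u1 => /(_ isT isT).
Qed.

(** In the tree this is distance at least 3. *)
Definition apart x y := (x != y) && ~~ sq x y.

Lemma nonbacktracking_apart x p :
  path e x p -> nonbacktracking (x :: p) -> 3 <= size p -> apart x (last x p).
Proof.
move=> pp rp sp; have up := nonbacktracking_uniq pp rp.
rewrite /apart (path_last_far pp up sp) andbT.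
by apply: contraTneq up => ->; case: p {pp rp} sp => //= y p _; rewrite mem_last.
Qed.

Definition gap_free := forall a b c d,
  sq a b -> sq c d -> apart a c -> apart a d -> apart b c -> apart b d -> False.

Hypothesis gap_freeE : gap_free.

Definition sq_ball x : {set V} := [set y | (y == x) || sq x y].

Definition sq_dominating x := sq_ball x == setT.

Lemma sq_ball_edge x y : e x y -> y \in sq_ball x.
Proof. by move=> xy; rewrite inE sq_edge // orbT. Qed.

Lemma sq_ball_path2 x y z : e x y -> e y z -> z \in sq_ball x.
Proof.
move=> xy yz; rewrite inE; case: eqVneq => //= nzx.
by apply: (@sq_common y); rewrite 1?eq_sym // symE.
Qed.

Lemma sq_ballP x y :
  reflect [\/ y = x, e x y | exists2 z, e x z & e z y] (y \in sq_ball x).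
Proof.
apply: (iffP idP) => [|[->|/sq_ball_edge|[z xz /(sq_ball_path2 xz)]]] //.
  by rewrite inE => /orP[/eqP->|/sqP[_ []]];
    by [constructor 1|constructor 2|constructor 3].
by rewrite inE eqxx.
Qed.

(* If [v] is at distance 3 from [x] through [a], then maximality of the ball at
   [x] gives a vertex [z] in it that is at distance 3 from [a]; the path
   z - b - x - a - u - v then has a gap between its end edges. *)
Lemma dominating_of_max_ball x :
  (forall y, #|sq_ball y| <= #|sq_ball x|) -> sq_dominating x.
Proof.
move=> maxx; apply: contraT => ndom.
have [w wB] : exists w, w \notin sq_ball x.
  by apply/existsP; apply: contraR ndom => /existsPn h;
    apply/eqP/setP => w; rewrite in_setT; apply/negPn/h.
(* A path from [x] to [w] must leave the ball along some edge. *)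
have [u [v [uB vB uv]]] : exists u v, [/\ u \in sq_ball x, v \notin sq_ball x & e u v].
  have [p pp ep] := connectP (conE x w); rewrite {}ep in wB.
  have: x \in sq_ball x by rewrite inE eqxx.
  elim: p {1 2 4}x pp wB => [|y p IH] z /=; first by move=> _ /negbTE->.
  case/andP => zy py el zB; have [yB|yB] := boolP (y \in sq_ball x).
    exact: IH py el yB.
  by exists z, y.
have [a xa au] : exists2 a, e x a & e a u.
  case/sq_ballP: uB => [ux|xu|//]; case/negP: vB.
    by rewrite sq_ball_edge // -ux.
  exact: sq_ball_path2 xu uv.
have av := sq_ball_path2 au uv.
(* Otherwise the ball at [a], which also contains [v], would be strictly larger than the ball at
   [x]. *)
have [z zx za] : exists2 z, z \in sq_ball x & z \notin sq_ball a.
  apply/subsetPn; apply: contraL (maxx a) => sub; rewrite -ltnNge proper_card //.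
  by apply/properP; split=> //; exists v.
have ax : e a x by rewrite symE.
have [b xb bz] : exists2 b, e x b & e b z.
  case/sq_ballP: zx => [zx|xz|//]; case/negP: za.
    by rewrite zx sq_ball_edge.
  exact: sq_ball_path2 ax xz.
have zb : e z b by rewrite symE.
have bx : e b x by rewrite symE.
have nzx : z != x by apply: contraNneq za => ->; apply: sq_ball_edge.
have nba : b != a by apply: contraNneq za => <-; apply: sq_ball_edge.
have nxu : x != u by apply: contraNneq vB => ->; apply: sq_ball_edge.
have nav : a != v by apply: contraNneq vB => <-; apply: sq_ball_edge.
case: (gap_freeE (sq_edge zb) (sq_edge uv)).
- by apply: (@nonbacktracking_apart z [:: b; x; a; u]);
    rewrite /= ?zb ?bx ?xa ?au ?nzx ?nba ?nxu.
- by apply: (@nonbacktracking_apart z [:: b; x; a; u; v]);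
    rewrite /= ?zb ?bx ?xa ?au ?uv ?nzx ?nba ?nxu ?nav.
- by apply: (@nonbacktracking_apart b [:: x; a; u]);
    rewrite /= ?bx ?xa ?au ?nba ?nxu.
- by apply: (@nonbacktracking_apart b [:: x; a; u; v]);
    rewrite /= ?bx ?xa ?au ?uv ?nba ?nxu ?nav.
Qed.

Lemma exists_dominating : exists x, sq_dominating x.
Proof.
have [_ /card_gt0P[x0 _] _ _] := tree_e.
have [x _ maxx] := @arg_maxnP _ x0 predT (fun x => #|sq_ball x|) isT.
by exists x; apply: dominating_of_max_ball => y; apply: maxx.
Qed.

(** Children are meant with respect to the root [x], and the condition concerns its neighbours
    only. *)
Definition at_most_one_child x :=
  forall y z1 z2, e x y -> e y z1 -> e y z2 -> z1 != x -> z2 != x -> z1 = z2.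

(** Take [x] dominating of largest degree. If a neighbour [y] had two children, they would be
    adjacent in the square, and gap-freeness would make all other neighbours of [x] leaves. Then [y]
    dominates too, so [x] has degree at least 3, and two neighbours of [x] other than [y] form a gap
    with the two children. *)
Lemma exists_center : exists2 x, sq_dominating x & at_most_one_child x.
Proof.
have [x0 dom0] := exists_dominating.
have [x domx maxx] := @arg_maxnP _ x0 sq_dominating (fun x => #|[set y | e x y]|) dom0.
exists x => // y z1 z2 xy yz1 yz2 nz1 nz2; apply/eqP; apply: contraT => nz.
have yx : e y x by rewrite symE.
have z12 := sq_common yz1 yz2 nz.
have apart_nbr z y' : e y z -> z != x -> e x y' -> y' != y -> apart z y'.
  move=> yz nzx xy' ny'; apply: (@nonbacktracking_apart z [:: y; x; y']) => //=.
    by rewrite symE yz yx xy'.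
  by rewrite nzx eq_sym ny'.
have leaf y' w : e x y' -> y' != y -> e y' w -> w = x.
  move=> xy' ny' y'w; apply/eqP; apply: contraT => nwx.
  have apart_child z : e y z -> z != x -> apart z w.
    move=> yz nzx; apply: (@nonbacktracking_apart z [:: y; x; y'; w]) => //=.
      by rewrite symE yz yx xy' y'w.
    by rewrite nzx eq_sym ny' eq_sym nwx.
  by case: (gap_freeE z12 (sq_edge y'w)); auto.
have domy : sq_dominating y.
  apply/eqP/setP => v; rewrite in_setT.
  have: v \in sq_ball x by rewrite (eqP domx).
  case/sq_ballP => [->|xv|[t xt tv]].
  - exact: sq_ball_edge.
  - exact: sq_ball_path2 yx xv.
  have [ty|ty] := eqVneq t y; first by rewrite sq_ball_edge // -ty.
  by rewrite (leaf t v) // sq_ball_edge.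
have : 1 < #|[set v | e x v] :\ y|.
  rewrite -ltnS; have := cardsD1 y [set v | e x v]; rewrite inE xy add1n => <-.
  apply: leq_trans (maxx y domy).
  have sub : [set x; z1; z2] \subset [set v | e y v].
    by apply/subsetP => v; rewrite !inE => /orP[/orP[]|] /eqP ->.
  apply: leq_trans (subset_leq_card sub).
  by rewrite -setUA !cardsU1 cards1 !inE negb_or !(eq_sym x) nz1 nz2 nz.
case/card_gt1P => [y1 [y2 []]]; rewrite !inE => /andP[n1 xy1] /andP[n2 xy2] n12.
by case: (gap_freeE z12 (sq_common xy1 xy2 n12)); auto.
Qed.

End TreeSquares.

(** * Isomorphism with a whiskered star around the center *)

Lemma graph_iso_of (V W : finType) (e : rel V) (f : rel W) (h : W -> V) :
  injective h -> (forall v, exists u, h u = v) ->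
  (forall u v, e (h u) (h v) = f u v) -> graph_iso e f.
Proof.
move=> inj /fin_all_exists[g hg] ef; exists g; split.
  by exists h => // u; apply: inj; rewrite hg.
by move=> u v; rewrite -ef !hg.
Qed.

Lemma graph_iso_trans (U V W : finType) (d : rel U) (e : rel V) (f : rel W) :
  graph_iso d e -> graph_iso e f -> graph_iso d f.
Proof.
move=> [g [bg hg]] [h [bh hh]]; exists (h \o g); split; first exact: bij_comp.
by move=> u v; rewrite hg hh.
Qed.

Section CenterToStar.

Variables (V : finType) (e : rel V) (x : V).
Hypotheses (tree_e : is_tree e) (dom_x : sq_dominating e x)
  (child_x : at_most_one_child e x).

Let symE : ssrbool.symmetric e. Proof. by case: tree_e => -[]. Qed.
Let irrE : irreflexive e. Proof. by case: tree_e => -[]. Qed.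

Definition outer : {set V} := [set y | (y != x) && ~~ e x y].

(** The default [x] is never reached on [outer], where domination supplies a midpoint. *)
Definition parent y := odflt x [pick z | e x z && e z y].

Lemma parentP y : y \in outer -> e x (parent y) /\ e (parent y) y.
Proof.
rewrite inE => /andP[nyx nxy]; rewrite /parent.
case: pickP => [z /andP[]//|no].
have: y \in sq_ball e x by rewrite (eqP dom_x).
case/(sq_ballP tree_e) => [yx|xy|[z xz zy]].
- by rewrite yx eqxx in nyx.
- by rewrite xy in nxy.
- by have := no z; rewrite xz zy.
Qed.

Lemma outer_neq y : y \in outer -> y != x.
Proof. by rewrite inE => /andP[]. Qed.

Lemma parent_inj : {in outer &, injective parent}.
Proof.
move=> y1 y2 o1 o2 e12; have [xp1 p1] := parentP o1; have [_ p2] := parentP o2.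
by apply: child_x xp1 p1 _ _ _; rewrite ?outer_neq // e12.
Qed.

(** This and the next two lemmas settle all adjacencies away from [x]: any edge beyond those of the
    whiskered star would close a cycle through [x]. *)
Lemma inner_nonadj z1 z2 : e x z1 -> e x z2 -> e z1 z2 = false.
Proof.
move=> xz1 xz2; apply/negP => z12.
have := @path_last_nonadj _ _ tree_e x [:: z1; z2].
rewrite /= xz1 z12 symE xz2 !inE negb_or !(edge_neq tree_e) //.
by move=> /(_ isT isT isT).
Qed.

Lemma outer_nonadj y1 y2 : y1 \in outer -> y2 \in outer -> e y1 y2 = false.
Proof.
move=> o1 o2; have [xp1 p1] := parentP o1; have [xp2 p2] := parentP o2.
have [e12|n12] := eqVneq (parent y1) (parent y2).
  by rewrite (parent_inj o1 o2 e12) irrE.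
have := @nonbacktracking_apart _ _ tree_e y1 [:: parent y1; x; parent y2; y2].
rewrite /= symE p1 symE xp1 xp2 p2 outer_neq // n12 eq_sym outer_neq //.
move=> /(_ isT isT isT)/andP[_ nsq]; apply: contraNF nsq; exact: sq_edge.
Qed.

Lemma inner_outer_adj z y : e x z -> y \in outer -> e z y = (z == parent y).
Proof.
move=> xz oy; have [xp py] := parentP oy; apply/idP/eqP => [zy|->//].
apply/eqP; apply: contraT => nzp.
have := @nonbacktracking_apart _ _ tree_e z [:: x; parent y; y].
rewrite /= symE xz xp py nzp eq_sym outer_neq //.
by move=> /(_ isT isT isT)/andP[_ /negP[]]; apply: sq_edge.
Qed.

Let sY := enum outer.
(** Parents come first, in the order of their children, so that equal indices mean adjacency; the
    neighbours without a child follow. *)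
Let sX := map parent sY ++ [seq z <- enum [set z | e x z] | z \notin map parent sY].

Let sY_outer j : j < size sY -> nth x sY j \in outer.
Proof. by move=> lt; rewrite -mem_enum mem_nth. Qed.

Let mem_sX z : (z \in sX) = e x z.
Proof.
rewrite mem_cat mem_filter mem_enum inE; case: (boolP (z \in map _ _)) => //=.
by case/mapP => y; rewrite mem_enum => /parentP[xp _] ->.
Qed.

Let uniq_sX : uniq sX.
Proof.
rewrite cat_uniq filter_uniq ?enum_uniq // andbT map_inj_in_uniq ?enum_uniq.
  by apply/hasPn => z; rewrite mem_filter => /andP[].
by move=> y1 y2; rewrite !mem_enum; apply: parent_inj.
Qed.

Let sX_nbr i : i < size sX -> e x (nth x sX i).
Proof. by move=> lt; rewrite -mem_sX mem_nth. Qed.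

Let h (u : option ('I_(size sX) + 'I_(size sY))) : V :=
  match u with
  | None => x
  | Some (inl i) => nth x sX i
  | Some (inr j) => nth x sY j
  end.

Lemma center_graph_iso :
  exists k m, m <= k /\ graph_iso e (wstar_graph k m).
Proof.
exists (size sX), (size sY); split; first by rewrite size_cat size_map leq_addr.
have adj i j : i < size sX -> j < size sY ->
    e (nth x sX i) (nth x sY j) = (i == j).
  move=> lti ltj; rewrite inner_outer_adj ?sX_nbr ?sY_outer //.
  have -> : parent (nth x sY j) = nth x sX j.
    by rewrite nth_cat size_map ltj (nth_map x).
  by rewrite nth_uniq // size_cat size_map ltn_addr.
apply: (@graph_iso_of _ _ _ _ h).
- have nX i : i < size sX -> nth x sX i != x.
    by move=> /sX_nbr; apply: contraTneq => ->; rewrite irrE.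
  have nY j : j < size sY -> nth x sY j != x by move=> /sY_outer/outer_neq.
  have nXY i j : i < size sX -> j < size sY -> nth x sX i != nth x sY j.
    move=> /sX_nbr xz /sY_outer; rewrite inE => /andP[_].
    by apply: contraNneq => <-.
  move=> [[i|j]|] [[i'|j']|] //= /eqP.
  + by rewrite nth_uniq // => /eqP/val_inj->.
  + by rewrite (negbTE (nXY _ _ _ _)).
  + by rewrite (negbTE (nX _ _)).
  + by rewrite eq_sym (negbTE (nXY _ _ _ _)).
  + by rewrite nth_uniq ?enum_uniq // => /eqP/val_inj->.
  + by rewrite (negbTE (nY _ _)).
  + by rewrite eq_sym (negbTE (nX _ _)).
  + by rewrite eq_sym (negbTE (nY _ _)).
- move=> v; have [->|nvx] := eqVneq v x; first by exists None.
  have [xv|nxv] := boolP (e x v).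
    have lt : index v sX < size sX by rewrite index_mem mem_sX.
    by exists (Some (inl (Ordinal lt))); rewrite /= nth_index // mem_sX.
  have vY : v \in sY by rewrite mem_enum inE nvx.
  have lt : index v sY < size sY by rewrite index_mem.
  by exists (Some (inr (Ordinal lt))); rewrite /= nth_index.
- move=> [[i|j]|] [[i'|j']|] /=.
  + by rewrite inner_nonadj // sX_nbr.
  + by rewrite adj.
  + by rewrite symE sX_nbr.
  + by rewrite symE adj.
  + by rewrite outer_nonadj // sY_outer.
  + by have := sY_outer (ltn_ord j); rewrite inE symE => /andP[_ /negbTE].
  + by rewrite sX_nbr.
  + by have := sY_outer (ltn_ord j'); rewrite inE => /andP[_ /negbTE].
  + exact: irrE.
Qed.

End CenterToStar.

(** The reconstruction may find no whisker at all; the tree is then a star. *)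
Lemma wstar_graph0_iso k : graph_iso (wstar_graph k 0) (star_graph k).
Proof.
apply: (@graph_iso_of _ _ _ _ (omap inl)).
- by move=> [i|] [j|] //= [->].
- by move=> [[i|[]]|] //; [exists (Some i)|exists None].
- by move=> [i|] [j|].
Qed.

(** * Split partitions of the squares of the listed trees *)

Definition split_by (W : finType) (f : rel W) (K : pred W) :=
  {in K &, forall x y, x != y -> f x y} /\ (forall x y, f x y -> K x || K y).

Lemma graph_square_iso (V W : finType) (e : rel V) (f : rel W) (g : V -> W) :
  bijective g -> (forall u v, e u v = f (g u) (g v)) ->
  forall u v, graph_square e u v = graph_square f (g u) (g v).
Proof.
move=> bg eg u v; rewrite /graph_square (bij_eq bg) eg; congr (_ && (_ || _)).
apply/existsP/existsP => -[z]; first by rewrite !eg; exists (g z).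
by case: bg => g' _ g'K; rewrite -[z]g'K -!eg; exists (g' z).
Qed.

(** The inner vertices 1, 2, 3 are pairwise within distance 2, while 0 and 4 are at distance 4. *)
Lemma split_path m : m <= 5 ->
  split_by (graph_square (path_graph m)) (fun i => 1 <= i <= 3).
Proof.
move=> le5; split=> [i j|i j].
  rewrite !unfold_in => hi hj ne; rewrite /graph_square ne /=.
  have [adj|nadj] := boolP (path_graph m i j); rewrite //=.
  have lt2 : 2 < m.
    have := ltn_ord i; have := ltn_ord j; move: nadj ne; rewrite /path_graph -val_eqE /=.
    lia.
  (* The only nonadjacent pair is 1 and 3, with common neighbour 2. *)
  apply/existsP; exists (Ordinal lt2); move: nadj ne; rewrite /path_graph -val_eqE /=.
  lia.
have := ltn_ord i; have := ltn_ord j.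
rewrite /graph_square -val_eqE /path_graph /= => ltj lti /andP[ne].
case/orP => [|/existsP[z]]; lia.
Qed.

(** All leaves share the center, so the square is complete. *)
Lemma split_star t : split_by (graph_square (star_graph t)) predT.
Proof.
split=> // -[i|] [j|] _ _ //=; rewrite /graph_square => -> //=.
by apply/existsP; exists None.
Qed.

(** The center and its neighbours form the clique; distinct whisker ends have no common
    neighbour. *)
Lemma split_wstar k m :
  split_by (graph_square (wstar_graph k m))
    (fun u => if u is Some (inr _) then false else true).
Proof.
split=> [[[i|j]|] [[i'|j']|] //= _ _|[[i|j]|] [[i'|j']|] //=];
  rewrite /graph_square.
- by move=> -> /=; apply/existsP; exists None.
- case/andP => ne /existsP[[[l|l]|]] //= /andP[/eqP lj /eqP lj'].
  by case/eqP: ne; congr (Some (inr _)); apply: val_inj; rewrite /= -lj.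
Qed.

Theorem theorem3p11 (F : fieldType) (n : nat) (e : rel 'I_n) :
  is_tree e -> 2 <= n ->
  (has_linear_resolution F n (graph_square e) <->
   [\/ exists2 m : nat, 2 <= m <= 5 & graph_iso e (path_graph m),
       exists2 t : nat, 1 <= t & graph_iso e (star_graph t)
     | exists k m : nat, [/\ 1 <= k, 1 <= m, m <= k &
                           graph_iso e (wstar_graph k m)]]).
Proof.
move=> te n2.
have irr : irreflexive (graph_square e) by move=> x; rewrite /graph_square eqxx.
have sym : ssrbool.symmetric (graph_square e) := sqC te.
split=> [lin|iso].
  have gap : gap_free e.
    move=> a b c d ab cd /andP[n1 a1] /andP[n2' a2] /andP[n3 a3] /andP[n4 a4].
    have := linear_resolution_gap irr sym lin ab cd n1 n2' n3 n4.
    by rewrite (negbTE a1) (negbTE a2) (negbTE a3) (negbTE a4).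
  have [x domx childx] := exists_center te gap.
  have [k [m [lemk iso]]] := center_graph_iso te domx childx.
  (* The tree has [1 + k + m] vertices with [m <= k], so [k = 0] would leave a single vertex. *)
  have k_gt0 : 0 < k.
    have [g [bg _]] := iso; have := bij_eq_card bg.
    rewrite card_option card_sum !card_ord; lia.
  case: m => [|m] in lemk iso *.
    by apply: Or32; exists k => //; apply: graph_iso_trans iso (wstar_graph0_iso k).
  by apply: Or33; exists k, m.+1.
(* All three families are treated alike: a split partition of the model's square is pulled back
   along the isomorphism. *)
suff [W [f [g [K [bg eg [clK cov]]]]]] : exists (W : finType) (f : rel W) (g : 'I_n -> W)
    (K : pred W), [/\ bijective g, forall u v, e u v = f (g u) (g v)
                    & split_by (graph_square f) K].
  have sqg := graph_square_iso bg eg.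
  apply: (@split_graph_linear _ _ _ [set v | K (g v)]) => // x y; rewrite ?inE.
    by move=> hx hy ne; rewrite sqg clK ?(bij_eq bg).
  by rewrite sqg => /cov.
case: iso => [[m /andP[_ m5]]|[t _]|[k [m [_ _ _]]]] [g [bg eg]];
  do 2!eexists; exists g; eexists; split; try exact: eg; try done.
- exact: split_path.
- exact: split_star.
- exact: split_wstar.
Qed.
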